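(* Let $X$ be a smooth connected variety over $\mathbb{C}$ and $n>2$ an integer. Let $\rho_n:\mathcal{G}_n\to\mathcal{G}_{n-1}$ be the canonical morphism of sheaves of groups on $X$. Then $\ker(\rho_n)\simeq T_X\oplus\mathcal{O}_X$ (as sheaves of groups).
   Context: For an open $U\subset X$ and $m\geq 1$, $\mathcal{G}_m(U)$ is the group of automorphisms of the $\mathbb{C}$-algebra $\mathcal{O}_X(U)[t]/(t^m)$ which induce the identity on its quotient $\mathcal{O}_X(U)$ by the ideal $(t)$. The morphism $\rho_n$ sends an automorphism of $\mathcal{O}_X(U)[t]/(t^n)$ to the induced automorphism of $\mathcal{O}_X(U)[t]/(t^{n-1})$. $T_X$ is the tangent sheaf of $X$.
   Formalization: The assignment of Aut(O_X(U)[t]/(t^m)) to every open U is not a presheaf on non-affine U; here a section of G_m over U is a family of such automorphisms, one for each open V in U, compatible with restriction (the automorphism sheaf of O_X[t]/(t^m)). *)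

(* Defs.v *)
From HB Require Import structures.
From mathcomp Require Import all_boot all_order all_algebra.
From mathcomp Require Import boolp classical_sets functions reals topology.
From mathcomp Require Import complex.
From mathcomp Require mpoly.

Set Implicit Arguments.
Unset Strict Implicit.
Unset Printing Implicit Defensive.

Import GRing.Theory.
Local Open Scope classical_set_scope.
Local Open Scope ring_scope.

Record opens (X : topologicalType) := Opens {
  oset : set X;
  osetP : open oset
}.

Notation "V '⊂' U" := (oset V `<=` oset U) (at level 70, no associativity).

Definition osub_refl (X : topologicalType) (U : opens X) : U ⊂ U :=
  fun x Ux => Ux.

Definition osub_trans (X : topologicalType) (U V W : opens X)
  (VU : V ⊂ U) (WV : W ⊂ V) : W ⊂ U := fun x Wx => VU x (WV x Wx).

Definition ocap (X : topologicalType) (U V : opens X) : opens X :=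
  Opens (openI (osetP U) (osetP V)).

Definition ocapl (X : topologicalType) (U V : opens X) : ocap U V ⊂ U :=
  fun x UVx => UVx.1.

Definition ocapr (X : topologicalType) (U V : opens X) : ocap U V ⊂ V :=
  fun x UVx => UVx.2.

(* The sheaf condition is stated for all coverings (D i) of U by open subsets;
   sections agree on overlaps when they agree on every open set contained in
   two members of the covering.  The proofs of inclusion are irrelevant. *)
Record is_sheaf (X : topologicalType) (F : opens X -> Type)
    (res : forall U V : opens X, V ⊂ U -> F U -> F V) : Prop := IsSheaf {
  sh_id : forall U (UU : U ⊂ U) (s : F U), res U U UU s = s;
  sh_comp : forall (U V W : opens X) (VU : V ⊂ U) (WV : W ⊂ V) (WU : W ⊂ U)
    (s : F U), res V W WV (res U V VU s) = res U W WU s;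
  sh_sep : forall (U : opens X) (I : Type) (D : I -> opens X)
    (DU : forall i, D i ⊂ U), (oset U `<=` \bigcup_i oset (D i)) ->
    forall s t : F U,
    (forall i, res U (D i) (DU i) s = res U (D i) (DU i) t) -> s = t;
  sh_glue : forall (U : opens X) (I : Type) (D : I -> opens X)
    (DU : forall i, D i ⊂ U), (oset U `<=` \bigcup_i oset (D i)) ->
    forall s : (forall i, F (D i)),
    (forall i j (W : opens X) (Wi : W ⊂ D i) (Wj : W ⊂ D j),
        res (D i) W Wi (s i) = res (D j) W Wj (s j)) ->
    exists t : F U, forall i, res U (D i) (DU i) t = s i
}.

Record gpSheaf (X : topologicalType) := GpSheaf {
  gsec :> opens X -> groupType;
  gres : forall U V : opens X, V ⊂ U -> gsec U -> gsec V;
  gresM : forall (U V : opens X) (VU : V ⊂ U),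
    {morph gres VU : s t / (s * t)%g};
  gresP : is_sheaf gres
}.

Record gpMor (X : topologicalType) (F G : gpSheaf X) := GpMor {
  gmor :> forall U : opens X, F U -> G U;
  gmorM : forall U : opens X, {morph @gmor U : s t / (s * t)%g};
  gmorR : forall (U V : opens X) (VU : V ⊂ U) (s : F U),
    gmor (gres VU s) = gres VU (gmor s)
}.

Definition gp_isomorphic (X : topologicalType) (F G : gpSheaf X) : Prop :=
  exists f : gpMor F G, forall U : opens X, bijective (@gmor X F G f U).

Lemma morphg1 (G H : groupType) (f : G -> H) :
  {morph f : s t / (s * t)%g} -> f 1%g = 1%g.
Proof. by move=> fM; apply: (mulgI (f 1%g)); rewrite -fM !mulg1. Qed.

Lemma morphgV (G H : groupType) (f : G -> H) :
  {morph f : s t / (s * t)%g} -> {morph f : s / (s^-1)%g}.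
Proof.
by move=> fM s; apply: (mulgI (f s)); rewrite -fM !mulgV morphg1.
Qed.

Section Kernel.
Variables (X : topologicalType) (F G : gpSheaf X) (f : gpMor F G).

Definition ker_pred (U : opens X) : {pred F U} := fun s => f U s == 1%g.

Lemma ker_pred_closed U : group_closed (@ker_pred U).
Proof.
split; first by rewrite unfold_in /ker_pred morphg1 //; apply: gmorM.
move=> s t; rewrite !unfold_in /ker_pred => /eqP s1 /eqP t1.
have fM := gmorM f (U := U).
by rewrite fM (morphgV fM) s1 t1 mulgV.
Qed.

Record ker_sec (U : opens X) := KerSec {
  ker_val :> F U;
  _ : ker_val \in @ker_pred U
}.

HB.instance Definition _ U := [isSub for @ker_val U].
HB.instance Definition _ U := [Choice of ker_sec U by <:].
HB.instance Definition _ U :=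
  SubChoice_isSubGroup.Build (F U) (@ker_pred U) (ker_sec U)
    (ker_pred_closed U).

Lemma ker_res_subproof U V (VU : V ⊂ U) (s : ker_sec U) :
  gres VU (val s) \in @ker_pred V.
Proof.
have := valP s; rewrite !unfold_in /ker_pred gmorR => /eqP ->.
by rewrite morphg1 //; apply: gresM.
Qed.

Definition ker_res U V (VU : V ⊂ U) (s : ker_sec U) : ker_sec V :=
  KerSec (ker_res_subproof VU s).

Lemma ker_resM U V (VU : V ⊂ U) :
  {morph ker_res VU : s t / (s * t)%g}.
Proof. by move=> s t; apply: val_inj; rewrite /= gresM. Qed.

Lemma ker_resP : is_sheaf ker_res.
Proof.
have [Fi Fc Fs Fg] := gresP F; have [_ _ Gs _] := gresP G.
split=> [U UU s|U V W VU WV WU s|U I D DU cov s t st|U I D DU cov s ss].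
- by apply: val_inj; rewrite /= Fi.
- by apply: val_inj; rewrite /= (Fc _ _ _ _ _ WU).
- by apply: val_inj; apply: (Fs U I D DU cov) => i; have /(congr1 val) := st i.
have [|t tE] := Fg U I D DU cov (fun i => val (s i)).
  by move=> i j W Wi Wj; have /(congr1 val) := ss i j W Wi Wj.
have tk : t \in @ker_pred U.
  rewrite unfold_in /ker_pred; apply/eqP; apply: (Gs U I D DU cov) => i.
  rewrite -gmorR tE morphg1; last exact: gresM.
  by have := valP (s i); rewrite unfold_in /ker_pred => /eqP.
by exists (KerSec tk) => i; apply: val_inj; rewrite /= tE.
Qed.

Definition ker_sheaf : gpSheaf X := GpSheaf ker_resM ker_resP.

End Kernel.

Record abSheaf (X : topologicalType) := AbSheaf {
  absec :> opens X -> zmodType;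
  abres : forall U V : opens X, V ⊂ U -> absec U -> absec V;
  abresD : forall (U V : opens X) (VU : V ⊂ U),
    {morph abres VU : s t / s + t};
  abresP : is_sheaf abres
}.

Section DirectSum.
Variables (X : topologicalType) (A B : abSheaf X).

Definition dsum_sec (U : opens X) : zmodType := (A U * B U)%type.

Definition dsum_res U V (VU : V ⊂ U) (s : dsum_sec U) : dsum_sec V :=
  (abres VU s.1, abres VU s.2).

Lemma dsum_resD U V (VU : V ⊂ U) : {morph dsum_res VU : s t / s + t}.
Proof. by move=> s t; rewrite /dsum_res /= !abresD. Qed.

Lemma dsum_resP : is_sheaf dsum_res.
Proof.
have [Ai Ac As Ag] := abresP A; have [Bi Bc Bs Bg] := abresP B.
split=> [U UU [s s']|U V W VU WV WU s|U I D DU cov s t st|U I D DU cov s ss].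
- by rewrite /dsum_res Ai Bi.
- by rewrite /dsum_res /= (Ac _ _ _ _ _ WU) (Bc _ _ _ _ _ WU).
- case: s t st => [s s'] [t t'] st; congr (_, _).
    by apply: (As U I D DU cov) => i; have [] := st i.
  by apply: (Bs U I D DU cov) => i; have [] := st i.
have [|t tE] := Ag U I D DU cov (fun i => (s i).1).
  by move=> i j W Wi Wj; have [] := ss i j W Wi Wj.
have [|u uE] := Bg U I D DU cov (fun i => (s i).2).
  by move=> i j W Wi Wj; have [] := ss i j W Wi Wj.
by exists (t, u) => i; rewrite /dsum_res /= tE uE; case: (s i).
Qed.

Definition dsum_sheaf : abSheaf X := AbSheaf dsum_resD dsum_resP.

End DirectSum.

(* [addgrp V] is the additive group of [V], written multiplicatively. *)
Definition addgrp (V : zmodType) : Type := V.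

HB.instance Definition _ (V : zmodType) := Choice.on (addgrp V).
HB.instance Definition _ (V : zmodType) :=
  isGroup.Build (addgrp V) (@addrA V) (@add0r V) (@addr0 V)
    (@addNr V) (@addrN V).

Definition ab_gpSheaf (X : topologicalType) (A : abSheaf X) : gpSheaf X :=
  @GpSheaf X (fun U => addgrp (A U)) (@abres X A) (@abresD X A) (abresP A).

(* Commutative algebras are given by their structure morphism, and the zero
   ring is allowed, since it is the ring of sections over the empty set. *)
Record calg (K : comPzRingType) := CAlg {
  calg_ring :> comPzRingType;
  calg_scal : {rmorphism K -> calg_ring}
}.

Record algSheaf (K : comPzRingType) (X : topologicalType) := AlgSheaf {
  asec :> opens X -> calg K;
  ares : forall U V : opens X, V ⊂ U -> {rmorphism asec U -> asec V};
  ares_scal : forall (U V : opens X) (VU : V ⊂ U) (c : K),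
    ares VU (calg_scal (asec U) c) = calg_scal (asec V) c;
  aresP : is_sheaf (fun U V VU => ares VU : asec U -> asec V)
}.

Definition add_sheaf (K : comPzRingType) (X : topologicalType)
    (O : algSheaf K X) : abSheaf X :=
  @AbSheaf X (fun U => O U) (fun U V VU => ares O VU)
    (fun U V VU => rmorphD (ares O VU)) (aresP O).

(* Given a sheaf [F] and for each open set [V] a set [E V] of endomaps of
   [F V], a section over [U] is a family of endomaps, one for each open subset
   of [U], which commutes with the restriction maps of [F], i.e., an
   endomorphism of the sheaf [F] restricted to [U]. *)
Section Families.
Variables (X : topologicalType) (F : opens X -> Type).
Variables (r : forall U V : opens X, V ⊂ U -> F U -> F V) (Fsh : is_sheaf r).
Variable E : opens X -> Type.
Variable act : forall V : opens X, E V -> F V -> F V.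

Record fam (U : opens X) := Fam {
  fam_val : forall V : opens X, V ⊂ U -> E V;
  famP : forall (V W : opens X) (VU : V ⊂ U) (WU : W ⊂ U) (WV : W ⊂ V)
    (p : F V), r WV (act (fam_val VU) p) = act (fam_val WU) (r WV p)
}.

HB.instance Definition _ U := gen_eqMixin (fam U).
HB.instance Definition _ U := gen_choiceMixin (fam U).

Lemma fam_eq U (s t : fam U) :
  (forall (V : opens X) (VU : V ⊂ U), fam_val s VU = fam_val t VU) -> s = t.
Proof.
case: s t => [s sP] [t tP] /= st.
have {}st : s = t.
  by apply: functional_extensionality_dep => V; apply: funext => VU.
by case: t / st tP => tP; congr Fam; apply: Prop_irrelevance.
Qed.

Definition fam_res U V (VU : V ⊂ U) (s : fam U) : fam V :=
  @Fam V (fun W WV => fam_val s (osub_trans VU WV))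
    (fun W W' WV W'V W'W => famP s (osub_trans VU WV) (osub_trans VU W'V) W'W).

Hypothesis act_inj : forall V (e e' : E V), act e =1 act e' -> e = e'.
Hypothesis act_local : forall (U : opens X) (I : Type) (D : I -> opens X)
  (DU : forall i, D i ⊂ U), (oset U `<=` \bigcup_i oset (D i)) ->
  forall (f : F U -> F U) (e : forall i, E (D i)),
    (forall i p, r (DU i) (f p) = act (e i) (r (DU i) p)) ->
    (forall i j (W : opens X) (Wi : W ⊂ D i) (Wj : W ⊂ D j),
      exists e' : E W,
        (forall p, r Wi (act (e i) p) = act e' (r Wi p)) /\
        (forall p, r Wj (act (e j) p) = act e' (r Wj p))) ->
  exists e : E U, act e =1 f.

Lemma fam_irr U (s : fam U) V (VU VU' : V ⊂ U) : fam_val s VU = fam_val s VU'.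
Proof. by congr fam_val; apply: Prop_irrelevance. Qed.

Lemma fam_resP : is_sheaf fam_res.
Proof.
have [Fi Fc Fs Fg] := Fsh.
have cc (U V : opens X) I (D : I -> opens X) : V ⊂ U ->
    oset U `<=` \bigcup_i oset (D i) ->
    oset V `<=` \bigcup_i oset (ocap V (D i)).
  by move=> VU cov x Vx; have [i _ Dx] := cov x (VU x Vx); exists i.
split=> [U UU s|U V W VU WV WU s|U I D DU cov s t st|U I D DU cov s ss].
- by apply: fam_eq => V VU /=; apply: fam_irr.
- by apply: fam_eq => V' V'W /=; apply: fam_irr.
- apply: fam_eq => V VU; apply: act_inj => p.
  apply: (Fs V I _ (fun i => @ocapl X V (D i)) (cc _ _ _ _ VU cov)) => i.
  have WU : ocap V (D i) ⊂ U := osub_trans VU (@ocapl X V (D i)).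
  rewrite !(famP _ VU WU); congr (act _ _).
  have := congr1 (fun z => fam_val z (@ocapr X V (D i))) (st i) => /=.
  by rewrite !(fam_irr _ _ WU).
have ssE i j (W : opens X) (Wi : W ⊂ D i) (Wj : W ⊂ D j) :
    fam_val (s i) Wi = fam_val (s j) Wj.
  have := congr1 (fun z => fam_val z (@osub_refl X W)) (ss i j W Wi Wj) => /=.
  by rewrite (fam_irr _ _ Wi) (fam_irr _ _ Wj).
have key (V : opens X) : V ⊂ U -> exists e : E V,
    forall i (W : opens X) (WV : W ⊂ V) (Wi : W ⊂ D i) p,
      r WV (act e p) = act (fam_val (s i) Wi) (r WV p).
  move=> VU; pose C i := ocap V (D i).
  have CV i : C i ⊂ V := @ocapl X V (D i).
  have CD i : C i ⊂ D i := @ocapr X V (D i).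
  have covC := cc _ _ _ _ VU cov.
  have glue p : {q | forall i,
      r (CV i) q = act (fam_val (s i) (CD i)) (r (CV i) p)}.
    apply: cid; apply: (Fg V I C CV covC
      (fun i => act (fam_val (s i) (CD i)) (r (CV i) p))).
    move=> i j W Wi Wj.
    rewrite (famP _ _ (osub_trans (CD i) Wi)) (famP _ _ (osub_trans (CD j) Wj)).
    rewrite (ssE i j W _ (osub_trans (CD j) Wj)); congr (act _ _).
    have WV := osub_trans (CV i) Wi.
    by rewrite !(Fc _ _ _ _ _ WV).
  pose f p := sval (glue p).
  have fE i p : r (CV i) (f p) = act (fam_val (s i) (CD i)) (r (CV i) p).
    exact: (svalP (glue p) i).
  have [||e eE] := @act_local V I C CV covC f (fun i => fam_val (s i) (CD i)).
  - exact: fE.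
  - move=> i j W Wi Wj; exists (fam_val (s i) (osub_trans (CD i) Wi)).
    split=> p; first exact: famP.
    by rewrite (ssE i j W _ (osub_trans (CD j) Wj)); apply: famP.
  exists e => i W WV Wi p; rewrite eE.
  have WC : W ⊂ C i by move=> x Wx; split; [exact: WV | exact: Wi].
  rewrite -(Fc _ _ _ (CV i) WC WV) fE (famP _ _ Wi).
  by rewrite (Fc _ _ _ (CV i) WC WV).
pose g (V : opens X) (VU : V ⊂ U) := sval (cid (key V VU)).
have gE V (VU : V ⊂ U) := svalP (cid (key V VU)).
have gP (V W : opens X) (VU : V ⊂ U) (WU : W ⊂ U) (WV : W ⊂ V) p :
    r WV (act (g V VU) p) = act (g W WU) (r WV p).
  apply: (Fs W I _ (fun i => @ocapl X W (D i)) (cc _ _ _ _ WU cov)) => i.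
  rewrite (gE W WU i _ _ (@ocapr X W (D i))).
  have CV := osub_trans WV (@ocapl X W (D i)).
  by rewrite !(Fc _ _ _ _ _ CV) (gE V VU i _ _ (@ocapr X W (D i))).
exists (Fam gP) => i; apply: fam_eq => V VD /=; apply: act_inj => p.
have := gE V (osub_trans (DU i) VD) i V (@osub_refl X V) VD p.
by rewrite !Fi.
Qed.

End Families.

(* [tpoly A m] is A[t]/(t^m), the polynomial sum_(i < m) p_i t^i being given
   by its coefficients.  The ring quotients of the library do not apply, since
   they exclude the zero ring. *)
Definition tpoly (A : comPzRingType) (m : nat) : Type := {ffun 'I_m -> A}.

HB.instance Definition _ (A : comPzRingType) (m : nat) :=
  GRing.Zmodule.on (tpoly A m).

Section Tpoly.
Variables (A : comPzRingType) (m : nat).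
Implicit Types p q s : tpoly A m.

Definition tcoef p (k : nat) : A := if insub k is Some i then p i else 0.

Definition tmk (c : nat -> A) : tpoly A m := [ffun i : 'I_m => c i].

Definition tmul p q : tpoly A m :=
  tmk (fun k => \sum_(i < k.+1) tcoef p i * tcoef q (k - i)).

Definition tconst (a : A) : tpoly A m :=
  tmk (fun k => if k == 0 then a else 0).

Definition tvar : tpoly A m := tmk (fun k => if k == 1%N then 1 else 0).

Lemma tcoef_mk c k : tcoef (tmk c) k = if (k < m)%N then c k else 0.
Proof.
rewrite /tcoef; case: insubP => [i -> <-|/negPf -> //].
by rewrite ffunE.
Qed.

Lemma tcoef_out p k : (m <= k)%N -> tcoef p k = 0.
Proof. by rewrite /tcoef leqNgt; case: insubP => [i -> |]. Qed.

Lemma tpolyP p q : (forall k, (k < m)%N -> tcoef p k = tcoef q k) -> p = q.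
Proof.
move=> pq; apply/ffunP => i; have := pq i (ltn_ord i).
by rewrite /tcoef valK.
Qed.

Lemma tcoefD p q k : tcoef (p + q) k = tcoef p k + tcoef q k.
Proof. by rewrite /tcoef; case: insub => [i|]; rewrite ?ffunE ?addr0. Qed.

Lemma tcoefN p k : tcoef (- p) k = - tcoef p k.
Proof. by rewrite /tcoef; case: insub => [i|]; rewrite ?ffunE ?oppr0. Qed.

Lemma tcoefB p q k : tcoef (p - q) k = tcoef p k - tcoef q k.
Proof. by rewrite tcoefD tcoefN. Qed.

Lemma tcoef0 k : tcoef 0 k = 0.
Proof. by rewrite /tcoef; case: insub => [i|]; rewrite ?ffunE. Qed.

Lemma tcoef_const a k :
  tcoef (tconst a) k = if (k < m)%N && (k == 0) then a else 0.
Proof. by rewrite tcoef_mk; case: ltnP => //=. Qed.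

Lemma tcoef_mul p q k : (k < m)%N ->
  tcoef (tmul p q) k = \sum_(i < k.+1) tcoef p i * tcoef q (k - i).
Proof. by move=> km; rewrite tcoef_mk km. Qed.

Lemma tcoef_mul_rev p q k : (k < m)%N ->
  tcoef (tmul p q) k = \sum_(i < k.+1) tcoef p (k - i) * tcoef q i.
Proof.
move=> km; rewrite tcoef_mul // (reindex_inj rev_ord_inj) /=.
by apply: eq_bigr => i _; rewrite (sub_ordK i).
Qed.

Lemma tmulC : commutative tmul.
Proof.
move=> p q; apply: tpolyP => k km; rewrite tcoef_mul // tcoef_mul_rev //.
by apply: eq_bigr => i _; rewrite mulrC.
Qed.

Lemma tmulA : associative tmul.
Proof.
move=> p q s; apply: tpolyP => i im; rewrite tcoef_mul // tcoef_mul_rev //.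
pose coef3 j k := tcoef p j * (tcoef q (i - j - k) * tcoef s k).
transitivity (\sum_(j < i.+1) \sum_(k < i.+1 | (k <= i - j)%N) coef3 j k).
  apply: eq_bigr => j _.
  rewrite tcoef_mul_rev ?(leq_ltn_trans (leq_subr _ _)) // big_distrr /=.
  by rewrite (big_ord_narrow_leq (leq_subr _ _)).
rewrite (exchange_big_dep predT) //=; apply: eq_bigr => k _.
transitivity (\sum_(j < i.+1 | (j <= i - k)%N) coef3 j k).
  by apply: eq_bigl => j; rewrite -ltnS -(ltnS j) -!subSn ?leq_ord // ltn_subCr.
rewrite tcoef_mul ?(leq_ltn_trans (leq_subr _ _)) //.
rewrite (big_ord_narrow_leq (leq_subr _ _)) big_distrl.
by apply: eq_bigr => j _; rewrite /coef3 mulrA subnAC.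
Qed.

Lemma tcoef_constM a p k : (k < m)%N -> tcoef (tmul (tconst a) p) k = a * tcoef p k.
Proof.
move=> km; rewrite tcoef_mul // big_ord_recl subn0 tcoef_const (leq_ltn_trans _ km) //=.
by rewrite big1 ?addr0 // => i _; rewrite tcoef_const andbF mul0r.
Qed.

Lemma tmul1 : left_id (tconst 1) tmul.
Proof. by move=> p; apply: tpolyP => k km; rewrite tcoef_constM // mul1r. Qed.

Lemma tmulDl : left_distributive tmul +%R.
Proof.
move=> p q s; apply: tpolyP => k km; rewrite tcoefD !tcoef_mul // -big_split.
by apply: eq_bigr => i _; rewrite tcoefD mulrDl.
Qed.

HB.instance Definition _ :=
  GRing.Zmodule_isComPzRing.Build (tpoly A m) tmulA tmulC tmul1 tmulDl.

Lemma tcoefM p q k : (k < m)%N ->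
  tcoef (p * q) k = \sum_(i < k.+1) tcoef p i * tcoef q (k - i).
Proof. exact: tcoef_mul. Qed.

Lemma tcoef1 k : tcoef (1 : tpoly A m) k = if (k < m)%N && (k == 0) then 1 else 0.
Proof. exact: tcoef_const. Qed.

Lemma tcoef_varM q k : (k < m)%N ->
  tcoef (tvar * q) k = if k is k'.+1 then tcoef q k' else 0.
Proof.
have vE i : tcoef tvar i = if (i < m)%N && (i == 1%N) then 1 else 0.
  by rewrite tcoef_mk; case: ltnP.
move=> km; rewrite tcoefM // big_ord_recl vE andbF mul0r add0r.
case: k km => [|k] km; first by rewrite big_ord0.
rewrite big_ord_recl vE /= (leq_trans _ km) // mul1r subn1 big1 ?addr0 //.
by move=> i _; rewrite vE andbF mul0r.
Qed.

Lemma tcoef_varXM j q k : (k < m)%N ->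
  tcoef (tvar ^+ j * q) k = if (j <= k)%N then tcoef q (k - j) else 0.
Proof.
elim: j k => [|j IH] k km; first by rewrite expr0 mul1r subn0.
rewrite exprS -mulrA tcoef_varM //; case: k km => // k km.
by rewrite IH // ltnW.
Qed.

Lemma tcoef_nilM u v j k : tcoef u 0 = 0 -> (k < j)%N -> (k < m)%N ->
  tcoef (u ^+ j * v) k = 0.
Proof.
move=> u0; elim: j k => // j IH k kj km.
rewrite exprS -mulrA tcoefM // big_ord_recl u0 mul0r add0r big1 // => i _.
have ik : (k - lift ord0 i < k)%N.
  by rewrite lift0 ltn_subrL /= (leq_ltn_trans _ (ltn_ord i)).
by rewrite IH ?mulr0 ?(leq_trans ik) // ltnW.
Qed.

End Tpoly.

Arguments tcoef {A m}.
Arguments tmk {A} m.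
Arguments tconst {A} m.

(* The canonical map A[t]/(t^m) -> A[t]/(t^m') for m' <= m; for m <= m' it is
   the section which extends the coefficients by zero. *)
Definition tred (A : comPzRingType) (m m' : nat) (p : tpoly A m) : tpoly A m' :=
  tmk m' (tcoef p).

Definition tmap (A B : comPzRingType) (f : A -> B) (m : nat) (p : tpoly A m) :
  tpoly B m := [ffun i => f (p i)].

Arguments tmap {A B} f {m} p.

Section TpolyAut.
Variables (K : comPzRingType) (A : calg K) (m : nat).

(* Automorphisms of the K-algebra A[t]/(t^m) which induce the identity on its
   quotient A by the ideal (t), the constant coefficient being the quotient
   map. *)
Definition is_taut (f : tpoly A m -> tpoly A m) : Prop :=
  [/\ {morph f : p q / p + q}, {morph f : p q / p * q},
      forall c : K, f (tconst m (calg_scal A c)) = tconst m (calg_scal A c),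
      bijective f &
      forall p, tcoef (f p) 0 = tcoef p 0].

Record taut := Taut { taut_fun :> tpoly A m -> tpoly A m; tautP : is_taut taut_fun }.

HB.instance Definition _ := gen_eqMixin taut.
HB.instance Definition _ := gen_choiceMixin taut.

Lemma taut_eq (f g : taut) : f =1 g -> f = g.
Proof.
case: f g => [f fP] [g gP] /= /funext fg.
by case: g / fg gP => gP; congr Taut; apply: Prop_irrelevance.
Qed.

Lemma taut1P : is_taut idfun.
Proof. by split=> //; exists idfun. Qed.

Lemma tautMP (f g : taut) : is_taut (f \o g).
Proof.
case: f g => [f [fD fM fc fb f0]] [g [gD gM gc gb g0]]; split => /=.
- by move=> p q /=; rewrite gD fD.
- by move=> p q /=; rewrite gM fM.
- by move=> c; rewrite gc fc.
- exact: bij_comp.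
- by move=> p; rewrite f0 g0.
Qed.

Lemma taut_inv_subproof (f : taut) :
  {g | is_taut g & cancel f g /\ cancel g f}.
Proof.
apply: cid2; case: f => f [fD fM fc [g fK gK] f0] /=; exists g => //; split.
- by move=> p q; apply: (can_inj fK); rewrite fD !gK.
- by move=> p q; apply: (can_inj fK); rewrite fM !gK.
- by move=> c; rewrite -{1}fc fK.
- by exists f.
- by move=> p; rewrite -f0 gK.
Qed.

Definition taut_inv (f : taut) : taut := Taut (s2valP (taut_inv_subproof f)).

Lemma taut_invK (f : taut) : cancel (taut_inv f) f.
Proof. exact: (s2valP' (taut_inv_subproof f)).2. Qed.

Lemma taut_invKV (f : taut) : cancel f (taut_inv f).
Proof. exact: (s2valP' (taut_inv_subproof f)).1. Qed.

Definition taut_one := Taut taut1P.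
Definition taut_mul (f g : taut) := Taut (tautMP f g).

Lemma taut_mulA : associative taut_mul.
Proof. by move=> f g h; apply: taut_eq. Qed.
Lemma taut_mul1 : left_id taut_one taut_mul.
Proof. by move=> f; apply: taut_eq. Qed.
Lemma taut_mulr1 : right_id taut_one taut_mul.
Proof. by move=> f; apply: taut_eq. Qed.
Lemma taut_mulV : left_inverse taut_one taut_inv taut_mul.
Proof. by move=> f; apply: taut_eq => p /=; apply: taut_invKV. Qed.
Lemma taut_mulrV : right_inverse taut_one taut_inv taut_mul.
Proof. by move=> f; apply: taut_eq => p /=; apply: taut_invK. Qed.

HB.instance Definition _ :=
  isGroup.Build taut taut_mulA taut_mul1 taut_mulr1 taut_mulV taut_mulrV.

End TpolyAut.

Section Tred.
Variables (A : comPzRingType) (m m' : nat) (le_m : (m' <= m)%N).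

Lemma tred_lift (q : tpoly A m') : tred m' (tred m q) = q.
Proof.
apply: tpolyP => k km'.
by rewrite !tcoef_mk km' (leq_trans km' le_m).
Qed.

Lemma tredD (p q : tpoly A m) : tred m' (p + q) = tred m' p + tred m' q.
Proof.
by apply: tpolyP => k km'; rewrite tcoefD !tcoef_mk km' tcoefD.
Qed.

Lemma tredM (p q : tpoly A m) : tred m' (p * q) = tred m' p * tred m' q.
Proof.
apply: tpolyP => k km'; rewrite tcoef_mk km' !tcoefM ?(leq_trans km') //.
apply: eq_bigr => i _; rewrite !tcoef_mk.
rewrite !(leq_ltn_trans _ km') ?leq_subr //.
by have := ltn_ord i; rewrite ltnS.
Qed.

Lemma tred_const (a : A) : tred m' (tconst m a) = tconst m' a.
Proof.
apply: tpolyP => k km'.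
by rewrite tcoef_mk !tcoef_const km' (leq_trans km' le_m).
Qed.

Lemma tred_eq (p q : tpoly A m) :
  (forall k, (k < m')%N -> tcoef p k = tcoef q k) -> tred m' p = tred m' q.
Proof. by move=> pq; apply: tpolyP => k km'; rewrite !tcoef_mk km' pq. Qed.

End Tred.

Section TautRed.
Variables (K : comPzRingType) (A : calg K) (m m' : nat) (le_m : (m' <= m)%N).

Lemma taut_tred (f : taut A m) (p q : tpoly A m) :
  tred m' p = tred m' q -> tred m' (f p) = tred m' (f q).
Proof.
case: f => f [fD fM fc fb f0] /= pq.
have fX j (u v : tpoly A m) : f (u ^+ j * v) = f u ^+ j * f v.
  by elim: j => [|j IH]; rewrite ?expr0 ?mul1r // !exprS -!mulrA fM IH.
pose d := p - q; pose s := tmk m (fun k => tcoef d (k + m')) : tpoly A m.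
have dE : d = tvar A m ^+ m' * s.
  apply: tpolyP => k km; rewrite tcoef_varXM //; case: leqP => [mk|km'].
    by rewrite tcoef_mk subnK // (leq_ltn_trans (leq_subr _ _)).
  have := congr1 (fun z => tcoef z k) pq; rewrite !tcoef_mk km' => pqk.
  by rewrite /d tcoefB pqk subrr.
have -> : p = d + q by rewrite /d subrK.
rewrite fD; apply: tred_eq => k km'.
rewrite tcoefD dE fX tcoef_nilM ?add0r //; last exact: leq_trans km' le_m.
by rewrite f0 tcoef_mk; case: ifP.
Qed.

Lemma taut_redP (f : taut A m) :
  is_taut (fun q : tpoly A m' => tred m' (f (tred m q))).
Proof.
have key (g : taut A m) p : tred m' (g (tred m (tred m' p))) = tred m' (g p).
  by apply: taut_tred; rewrite tred_lift.
case: (tautP f) => fD fM fc _ f0; split.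
- by move=> p q; rewrite -tredD -fD; apply: taut_tred; rewrite tredD.
- move=> p q; rewrite -tredM // -fM; apply: taut_tred.
  by rewrite [RHS](tredM le_m) !tred_lift.
- by move=> c; rewrite -(tred_const le_m) key fc.
- exists (fun q => tred m' (taut_inv f (tred m q))) => q.
    by rewrite key taut_invKV tred_lift.
  by rewrite key taut_invK tred_lift.
- move=> q; rewrite !tcoef_mk; case: ltnP => // m'0; last by rewrite tcoef_out.
  by rewrite f0 tcoef_mk (leq_trans m'0 le_m).
Qed.

(* The automorphism of A[t]/(t^m') induced by an automorphism of A[t]/(t^m). *)
Definition taut_red (f : taut A m) : taut A m' := Taut (taut_redP f).

Lemma taut_redE (f : taut A m) p : taut_red f (tred m' p) = tred m' (f p).
Proof. by apply: taut_tred; rewrite tred_lift. Qed.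

Lemma taut_redM : {morph taut_red : f g / (f * g)%g}.
Proof.
move=> f g; apply: taut_eq => q.
have [p ->] : exists p : tpoly A m, q = tred m' p.
  by exists (tred m q); rewrite (tred_lift le_m).
rewrite taut_redE; change (tred m' (f (g p)) = taut_red f (taut_red g (tred m' p))).
by rewrite !taut_redE.
Qed.

End TautRed.

Section TpolyMap.
Variables (A B : comPzRingType) (f : {rmorphism A -> B}) (m : nat).

Lemma tcoef_map (p : tpoly A m) k : tcoef (tmap f p) k = f (tcoef p k).
Proof. by rewrite /tcoef; case: insub => [i|]; rewrite ?ffunE ?rmorph0. Qed.

Lemma tmapD (p q : tpoly A m) : tmap f (p + q) = tmap f p + tmap f q.
Proof.
by apply: tpolyP => k km; rewrite !(tcoefD, tcoef_map) rmorphD.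
Qed.

Lemma tmapM (p q : tpoly A m) : tmap f (p * q) = tmap f p * tmap f q.
Proof.
apply: tpolyP => k km; rewrite tcoefM // tcoef_map tcoefM // rmorph_sum.
by apply: eq_bigr => i _; rewrite rmorphM !tcoef_map.
Qed.

Lemma tmap_const a : tmap f (tconst m a) = tconst m (f a).
Proof.
by apply: tpolyP => k km; rewrite tcoef_map !tcoef_const; case: ifP; rewrite ?rmorph0.
Qed.

End TpolyMap.

Lemma tmap_red (A B : comPzRingType) (f : {rmorphism A -> B}) (m m' : nat)
  (p : tpoly A m) : tmap f (tred m' p) = tred m' (tmap f p).
Proof.
by apply: tpolyP => k km'; rewrite tcoef_map !tcoef_mk km' tcoef_map.
Qed.

Section AutSheaf.
Variables (K : comPzRingType) (X : topologicalType) (O : algSheaf K X).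
Variable m : nat.

Definition tres (U V : opens X) (VU : V ⊂ U) : tpoly (O U) m -> tpoly (O V) m :=
  tmap (ares O VU).

Lemma tcoef_res U V (VU : V ⊂ U) p k :
  tcoef (tres VU p) k = ares O VU (tcoef p k).
Proof. exact: tcoef_map. Qed.

Lemma tresD U V (VU : V ⊂ U) : {morph tres VU : p q / p + q}.
Proof. exact: tmapD. Qed.

Lemma tresM U V (VU : V ⊂ U) : {morph tres VU : p q / p * q}.
Proof. exact: tmapM. Qed.

Lemma tres_scal U V (VU : V ⊂ U) c :
  tres VU (tconst m (calg_scal (O U) c)) = tconst m (calg_scal (O V) c).
Proof. by rewrite /tres tmap_const ares_scal. Qed.

Lemma tresP : is_sheaf tres.
Proof.
have [Oi Oc Os Og] := aresP O.
split=> [U UU s|U V W VU WV WU s|U I D DU cov s t st|U I D DU cov s ss].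
- by apply: tpolyP => k km; rewrite tcoef_res Oi.
- by apply: tpolyP => k km; rewrite !tcoef_res (Oc _ _ _ _ _ WU).
- apply: tpolyP => k km; apply: (Os U I D DU cov) => i.
  by rewrite -!tcoef_res st.
have glue k : {t | forall i, ares O (DU i) t = tcoef (s i) k}.
  apply: cid; apply: (Og U I D DU cov (fun i => tcoef (s i) k)).
  by move=> i j W Wi Wj; rewrite -!tcoef_res (ss i j W Wi Wj).
exists (tmk m (fun k => sval (glue k))) => i; apply: tpolyP => k km.
by rewrite tcoef_res tcoef_mk km (svalP (glue k) i).
Qed.

Lemma taut_local (U : opens X) (I : Type) (D : I -> opens X)
  (DU : forall i, D i ⊂ U) : (oset U `<=` \bigcup_i oset (D i)) ->
  forall (f : tpoly (O U) m -> tpoly (O U) m) (e : forall i, taut (O (D i)) m),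
    (forall i p, tres (DU i) (f p) = e i (tres (DU i) p)) ->
    (forall i j (W : opens X) (Wi : W ⊂ D i) (Wj : W ⊂ D j),
      exists e' : taut (O W) m,
        (forall p, tres Wi (e i p) = e' (tres Wi p)) /\
        (forall p, tres Wj (e j p) = e' (tres Wj p))) ->
  exists e : taut (O U) m, e =1 f.
Proof.
have [Fi Fc Fs Fg] := tresP; have [_ _ Os _] := aresP O.
move=> cov f e fe ee.
suff fP : is_taut f by exists (Taut fP).
split.
- move=> p q; apply: (Fs U I D DU cov) => i.
  by have [eD _ _ _ _] := tautP (e i); rewrite fe !tresD eD -!fe.
- move=> p q; apply: (Fs U I D DU cov) => i.
  by have [_ eM _ _ _] := tautP (e i); rewrite fe !tresM eM -!fe.
- move=> c; apply: (Fs U I D DU cov) => i.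
  have [_ _ ec _ _] := tautP (e i).
  by rewrite fe tres_scal ec.
- have glue q : {p | forall i, tres (DU i) p = taut_inv (e i) (tres (DU i) q)}.
    apply: cid; apply: (Fg U I D DU cov
      (fun i => taut_inv (e i) (tres (DU i) q))) => i j W Wi Wj.
    have [e' [e'i e'j]] := ee i j W Wi Wj.
    apply: (can_inj (taut_invKV e')); rewrite -e'i -e'j !taut_invK.
    by rewrite !(Fc _ _ _ _ _ (osub_trans (DU i) Wi)).
  exists (fun q => sval (glue q)) => p; apply: (Fs U I D DU cov) => i.
    by rewrite (svalP (glue _) i) fe taut_invKV.
  by rewrite fe (svalP (glue p) i) taut_invK.
- move=> p; apply: (Os U I D DU cov) => i.
  have [_ _ _ _ e0] := tautP (e i).
  by rewrite -!tcoef_res fe e0.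
Qed.

(* An automorphism of the algebra O(U)[t]/(t^m) need not induce automorphisms
   of O(V)[t]/(t^m) for the open sets V in U, unless U is affine.  A section
   over U is thus a family of automorphisms of the algebras O(V)[t]/(t^m),
   inducing the identity on O(V), one for each open V in U, which commute with
   restrictions. *)
Definition aut_sec (U : opens X) : Type :=
  fam tres (fun V => @taut_fun K (O V) m) U.

HB.instance Definition _ U := Choice.on (aut_sec U).

Implicit Types U V W : opens X.

Definition aut_val U (s : aut_sec U) V (VU : V ⊂ U) : taut (O V) m :=
  fam_val s VU.

Lemma aut_valP U (s : aut_sec U) V W (VU : V ⊂ U) (WU : W ⊂ U) (WV : W ⊂ V) p :
  tres WV (aut_val s VU p) = aut_val s WU (tres WV p).
Proof. exact: (famP s VU WU WV p). Qed.

Lemma aut_mul_subproof U (s t : aut_sec U) V W (VU : V ⊂ U) (WU : W ⊂ U)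
  (WV : W ⊂ V) p :
  tres WV ((aut_val s VU * aut_val t VU)%g p) =
  (aut_val s WU * aut_val t WU)%g (tres WV p).
Proof. by rewrite /= (aut_valP s VU WU) (aut_valP t VU WU). Qed.

Lemma aut_inv_subproof U (s : aut_sec U) V W (VU : V ⊂ U) (WU : W ⊂ U)
  (WV : W ⊂ V) p :
  tres WV ((aut_val s VU)^-1%g p) = (aut_val s WU)^-1%g (tres WV p).
Proof.
apply: (can_inj (taut_invKV (aut_val s WU))).
by rewrite -(aut_valP s VU WU) !taut_invK.
Qed.

Definition aut_mul U (s t : aut_sec U) : aut_sec U :=
  Fam (fam_val := fun V VU => (aut_val s VU * aut_val t VU)%g)
    (aut_mul_subproof s t).

Definition aut_one U : aut_sec U :=
  @Fam X _ tres _ (fun V => @taut_fun K (O V) m) U (fun V _ => 1%g)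
    (fun V W _ _ WV p => erefl).

Definition aut_inv U (s : aut_sec U) : aut_sec U :=
  Fam (fam_val := fun V VU => (aut_val s VU)^-1%g) (aut_inv_subproof s).

Lemma aut_mulA U : associative (@aut_mul U).
Proof. by move=> s t u; apply: fam_eq => V VU /=; apply: mulgA. Qed.
Lemma aut_mul1 U : left_id (aut_one U) (@aut_mul U).
Proof. by move=> s; apply: fam_eq => V VU /=; apply: mul1g. Qed.
Lemma aut_mulr1 U : right_id (aut_one U) (@aut_mul U).
Proof. by move=> s; apply: fam_eq => V VU /=; apply: mulg1. Qed.
Lemma aut_mulV U : left_inverse (aut_one U) (@aut_inv U) (@aut_mul U).
Proof. by move=> s; apply: fam_eq => V VU /=; apply: mulVg. Qed.
Lemma aut_mulrV U : right_inverse (aut_one U) (@aut_inv U) (@aut_mul U).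
Proof. by move=> s; apply: fam_eq => V VU /=; apply: mulgV. Qed.

HB.instance Definition _ U :=
  isGroup.Build (aut_sec U) (@aut_mulA U) (@aut_mul1 U) (@aut_mulr1 U)
    (@aut_mulV U) (@aut_mulrV U).

Definition aut_res U V (VU : V ⊂ U) : aut_sec U -> aut_sec V :=
  @fam_res X _ tres _ _ U V VU.

Lemma aut_resM U V (VU : V ⊂ U) : {morph aut_res VU : s t / (s * t)%g}.
Proof. by move=> s t; apply: fam_eq. Qed.

Lemma aut_resP : is_sheaf aut_res.
Proof.
apply: fam_resP; [exact: tresP | by move=> V e e'; exact: taut_eq |].
exact: taut_local.
Qed.

Definition autSheaf : gpSheaf X := @GpSheaf X aut_sec aut_res aut_resM aut_resP.

End AutSheaf.

Section Rho.
Variables (K : comPzRingType) (X : topologicalType) (O : algSheaf K X).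
Variables (m m' : nat) (le_m : (m' <= m)%N).

Lemma tres_red (U V : opens X) (VU : V ⊂ U) (p : tpoly (O U) m) :
  tres VU (tred m' p) = tred m' (tres VU p).
Proof. exact: tmap_red. Qed.

Lemma aut_red_subproof U (s : autSheaf O m U) (V W : opens X) (VU : V ⊂ U)
  (WU : W ⊂ U) (WV : W ⊂ V) (q : tpoly (O V) m') :
  tres WV (taut_red le_m (aut_val s VU) q) =
  taut_red le_m (aut_val s WU) (tres WV q).
Proof.
have [p ->] : exists p : tpoly (O V) m, q = tred m' p.
  by exists (tred m q); rewrite (tred_lift le_m).
by rewrite taut_redE !tres_red (aut_valP s VU WU) taut_redE.
Qed.

Definition aut_red (U : opens X) (s : autSheaf O m U) : autSheaf O m' U :=
  Fam (fam_val := fun V VU => taut_red le_m (aut_val s VU)) (aut_red_subproof s).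

Lemma aut_redM (U : opens X) : {morph @aut_red U : s t / (s * t)%g}.
Proof. by move=> s t; apply: fam_eq => V VU; apply: taut_redM. Qed.

Lemma aut_redR (U V : opens X) (VU : V ⊂ U) (s : autSheaf O m U) :
  aut_red (gres VU s) = gres VU (aut_red s).
Proof. exact: fam_eq. Qed.

Definition aut_redMor : gpMor (autSheaf O m) (autSheaf O m') :=
  GpMor aut_redM aut_redR.

End Rho.

Definition rho (K : comPzRingType) (X : topologicalType) (O : algSheaf K X)
    (n : nat) : gpMor (autSheaf O n) (autSheaf O n.-1) :=
  aut_redMor O (leq_pred n).

Section Derivations.
Variables (K : comPzRingType) (A : calg K).

(* K-linearity follows from the Leibniz rule and the last condition. *)
Definition is_der (D : A -> A) : Prop :=
  [/\ {morph D : a b / a + b}, forall a b, D (a * b) = a * D b + b * D a &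
      forall c : K, D (calg_scal A c) = 0].

Definition der_pred : {pred A -> A} := fun D => `[< is_der D >].

Lemma der_pred_closed : zmod_closed der_pred.
Proof.
split.
  apply/asboolP; split=> [a b|a b|//]; first exact: (esym (addr0 0)).
  by change (0 = a * 0 + b * 0 :> A); rewrite !mulr0 addr0.
move=> D E /asboolP[DD DM Dc] /asboolP[ED EM Ec]; apply/asboolP; split=> /=.
- by move=> a b; rewrite /= !fctE DD ED opprD addrACA.
- move=> a b; rewrite /= !fctE DM EM !mulrDr !mulrN opprD.
  by rewrite addrACA.
- by move=> c; rewrite /= !fctE Dc Ec subr0.
Qed.

Record der := Der { der_fun :> A -> A; _ : der_fun \in der_pred }.

HB.instance Definition _ := [isSub for der_fun].
HB.instance Definition _ := [Choice of der by <:].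
HB.instance Definition _ :=
  GRing.SubChoice_isSubZmodule.Build (A -> A) der_pred der der_pred_closed.

Lemma derP (D : der) : is_der D.
Proof. by have /asboolP := valP D. Qed.

Lemma der_eq (D E : der) : D =1 E -> D = E.
Proof. by move=> DE; apply: val_inj; apply: funext. Qed.

End Derivations.

Section TangentSheaf.
Variables (K : comPzRingType) (X : topologicalType) (O : algSheaf K X).

Let r (U V : opens X) (VU : V ⊂ U) : O U -> O V := ares O VU.

Lemma der_local (U : opens X) (I : Type) (D : I -> opens X)
  (DU : forall i, D i ⊂ U) : (oset U `<=` \bigcup_i oset (D i)) ->
  forall (f : O U -> O U) (e : forall i, der (O (D i))),
    (forall i p, r (DU i) (f p) = e i (r (DU i) p)) ->
    (forall i j (W : opens X) (Wi : W ⊂ D i) (Wj : W ⊂ D j),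
      exists e' : der (O W),
        (forall p, r Wi (e i p) = e' (r Wi p)) /\
        (forall p, r Wj (e j p) = e' (r Wj p))) ->
  exists e : der (O U), e =1 f.
Proof.
have [_ _ Os _] := aresP O.
move=> cov f e fe _.
suff /asboolP fP : is_der f by exists (Der fP).
split.
- move=> a b; apply: (Os U I D DU cov) => i.
  have [eD _ _] := derP (e i).
  by have := fe i; rewrite /r => ->; rewrite !rmorphD eD -!fe.
- move=> a b; apply: (Os U I D DU cov) => i.
  have [_ eM _] := derP (e i).
  by have := fe i; rewrite /r => ->; rewrite rmorphM eM rmorphD !rmorphM -!fe.
- move=> c; apply: (Os U I D DU cov) => i.
  have [_ _ ec] := derP (e i).
  by have := fe i; rewrite /r => ->; rewrite ares_scal ec rmorph0.
Qed.

(* T = Der_K(O, O): a section over U is a K-derivation of the sheaf O|_U. *)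
Definition tan_sec (U : opens X) : Type :=
  fam r (fun V => @der_fun K (O V)) U.

HB.instance Definition _ U := Choice.on (tan_sec U).

Implicit Types U V W : opens X.

Definition tan_val U (s : tan_sec U) V (VU : V ⊂ U) : der (O V) := fam_val s VU.

Lemma tan_valP U (s : tan_sec U) V W (VU : V ⊂ U) (WU : W ⊂ U) (WV : W ⊂ V) p :
  r WV (tan_val s VU p) = tan_val s WU (r WV p).
Proof. exact: (famP s VU WU WV p). Qed.

Lemma tan_add_subproof U (s t : tan_sec U) V W (VU : V ⊂ U) (WU : W ⊂ U)
  (WV : W ⊂ V) p :
  r WV ((tan_val s VU + tan_val t VU) p) =
  (tan_val s WU + tan_val t WU) (r WV p).
Proof.
transitivity (r WV (tan_val s VU p) + r WV (tan_val t VU p)).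
  exact: (rmorphD (ares O WV)).
by rewrite (tan_valP s VU WU) (tan_valP t VU WU).
Qed.

Lemma tan_opp_subproof U (s : tan_sec U) V W (VU : V ⊂ U) (WU : W ⊂ U)
  (WV : W ⊂ V) p : r WV ((- tan_val s VU) p) = (- tan_val s WU) (r WV p).
Proof.
transitivity (- r WV (tan_val s VU p)); first exact: (rmorphN (ares O WV)).
by rewrite (tan_valP s VU WU).
Qed.

Lemma tan_zero_subproof V W (WV : W ⊂ V) p :
  r WV ((0 : der (O V)) p) = (0 : der (O W)) (r WV p).
Proof. exact: (rmorph0 (ares O WV)). Qed.

Definition tan_add U (s t : tan_sec U) : tan_sec U :=
  Fam (fam_val := fun V VU => tan_val s VU + tan_val t VU)
    (tan_add_subproof s t).

Definition tan_opp U (s : tan_sec U) : tan_sec U :=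
  Fam (fam_val := fun V VU => - tan_val s VU) (tan_opp_subproof s).

Definition tan_zero U : tan_sec U :=
  Fam (fam_val := fun V (_ : V ⊂ U) => 0 : der (O V))
    (fun V W _ _ WV => tan_zero_subproof WV).

Lemma tan_addA U : associative (@tan_add U).
Proof. by move=> s t u; apply: fam_eq => V VU /=; apply: addrA. Qed.
Lemma tan_addC U : commutative (@tan_add U).
Proof. by move=> s t; apply: fam_eq => V VU /=; apply: addrC. Qed.
Lemma tan_add0 U : left_id (tan_zero U) (@tan_add U).
Proof. by move=> s; apply: fam_eq => V VU /=; apply: add0r. Qed.
Lemma tan_addN U : left_inverse (tan_zero U) (@tan_opp U) (@tan_add U).
Proof. by move=> s; apply: fam_eq => V VU /=; apply: addNr. Qed.

HB.instance Definition _ U :=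
  GRing.isZmodule.Build (tan_sec U) (@tan_addA U) (@tan_addC U) (@tan_add0 U)
    (@tan_addN U).

Definition tan_res U V (VU : V ⊂ U) : tan_sec U -> tan_sec V :=
  @fam_res X _ r _ _ U V VU.

Lemma tan_resD U V (VU : V ⊂ U) : {morph tan_res VU : s t / s + t}.
Proof. by move=> s t; apply: fam_eq. Qed.

Lemma tan_resP : is_sheaf tan_res.
Proof.
apply: fam_resP; [exact: aresP | by move=> V e e'; exact: der_eq |].
exact: der_local.
Qed.

Definition tangentSheaf : abSheaf X :=
  @AbSheaf X tan_sec tan_res tan_resD tan_resP.

End TangentSheaf.

Definition opoint (X : topologicalType) (U : opens X) : Type := {x : X | oset U x}.

Definition oincl (X : topologicalType) (U V : opens X) (VU : V ⊂ U)
  (x : opoint V) : opoint U := exist _ (sval x) (VU _ (svalP x)).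

(* A topological space with, for each open set U, a C-algebra of functions
   from U to C, said to be regular, regularity being a local condition. *)
Record fspace (R : realType) := FSpace {
  fs_top :> topologicalType;
  regular : forall U : opens fs_top, set (opoint U -> R[i]);
  regular_cst : forall (U : opens fs_top) (c : R[i]), regular (cst c : opoint U -> R[i]);
  regularB : forall (U : opens fs_top) (f g : opoint U -> R[i]),
    regular f -> regular g -> regular (f \- g);
  regularM : forall (U : opens fs_top) (f g : opoint U -> R[i]),
    regular f -> regular g -> regular (f \* g);
  regular_res : forall (U V : opens fs_top) (VU : V ⊂ U) (f : opoint U -> R[i]),
    regular f -> regular (f \o oincl VU);
  regular_local : forall (U : opens fs_top) (f : opoint U -> R[i]),
    (forall x : opoint U, exists (V : opens fs_top) (VU : V ⊂ U),
      oset V (sval x) /\ regular (f \o oincl VU)) ->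
    regular f
}.

Section StructureSheaf.
Variables (R : realType) (X : fspace R).
Implicit Types U V W : opens X.

Definition reg_pred U : {pred opoint U -> R[i]} := fun f => `[< regular f >].

Lemma reg_pred_closed U : subring_closed (@reg_pred U).
Proof.
split.
- by apply/asboolP; exact: (regular_cst U 1).
- by move=> f g /asboolP fr /asboolP gr; apply/asboolP; exact: regularB.
- by move=> f g /asboolP fr /asboolP gr; apply/asboolP; exact: regularM.
Qed.

Record reg_fun U := RegFun { reg_val :> opoint U -> R[i]; _ : reg_val \in @reg_pred U }.

HB.instance Definition _ U := [isSub for @reg_val U].
HB.instance Definition _ U := [Choice of reg_fun U by <:].
HB.instance Definition _ U :=
  GRing.SubChoice_isSubComPzRing.Build (opoint U -> R[i]) (@reg_pred U) (reg_fun U)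
    (reg_pred_closed U).

Lemma reg_funP U (f : reg_fun U) : regular f.
Proof. by have /asboolP := valP f. Qed.

Lemma reg_fun_eq U (f g : reg_fun U) : (forall x, f x = g x) -> f = g.
Proof. by move=> fg; apply: val_inj; apply: funext. Qed.

Definition mk_reg U (f : opoint U -> R[i]) (fr : regular f) : reg_fun U :=
  RegFun (introT (asboolP _) fr).

Definition reg_scal U (c : R[i]) : reg_fun U := mk_reg (regular_cst U c).

Lemma reg_scal_zmod U : zmod_morphism (reg_scal U).
Proof. by move=> c d; apply: reg_fun_eq. Qed.

Lemma reg_scal_monoid U : monoid_morphism (reg_scal U).
Proof. by split=> [|c d]; apply: reg_fun_eq. Qed.

HB.instance Definition _ U :=
  GRing.isZmodMorphism.Build _ _ (reg_scal U) (reg_scal_zmod U).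
HB.instance Definition _ U :=
  GRing.isMonoidMorphism.Build _ _ (reg_scal U) (reg_scal_monoid U).

Definition reg_res U V (VU : V ⊂ U) (f : reg_fun U) : reg_fun V :=
  mk_reg (regular_res VU (reg_funP f)).

Lemma reg_res_zmod U V (VU : V ⊂ U) : zmod_morphism (reg_res VU).
Proof. by move=> c d; apply: reg_fun_eq. Qed.

Lemma reg_res_monoid U V (VU : V ⊂ U) : monoid_morphism (reg_res VU).
Proof. by split=> [|c d]; apply: reg_fun_eq. Qed.

HB.instance Definition _ U V (VU : V ⊂ U) :=
  GRing.isZmodMorphism.Build _ _ (reg_res VU) (reg_res_zmod VU).
HB.instance Definition _ U V (VU : V ⊂ U) :=
  GRing.isMonoidMorphism.Build _ _ (reg_res VU) (reg_res_monoid VU).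

Lemma opoint_eq U (x y : opoint U) : sval x = sval y -> x = y.
Proof.
case: x y => [x Ux] [y Uy] /= xy; case: y / xy Uy => Uy.
by congr exist; apply: Prop_irrelevance.
Qed.

Lemma reg_resP : is_sheaf reg_res.
Proof.
split=> [U UU s|U V W VU WV WU s|U I D DU cov s t st|U I D DU cov s ss].
- by apply: reg_fun_eq => x /=; congr (reg_val s _); apply: opoint_eq.
- by apply: reg_fun_eq => x /=; congr (reg_val s _); apply: opoint_eq.
- apply: reg_fun_eq => x; have [i _ Dx] := cov _ (svalP x).
  have /(congr1 (fun f => reg_val f (exist _ _ Dx : opoint (D i)))) /= := st i.
  by have -> : oincl (DU i) (exist _ (sval x) Dx) = x by exact: opoint_eq.
have idx (x : opoint U) : {i | oset (D i) (sval x)}.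
  by apply: cid; have [i _ Dx] := cov _ (svalP x); exists i.
pose f (x : opoint U) := s (sval (idx x)) (exist _ (sval x) (svalP (idx x))).
have fE i (y : opoint (D i)) : f (oincl (DU i) y) = s i y.
  rewrite /f; set x := oincl _ _; case: (idx x) => j /= Djx.
  pose W := ocap (D j) (D i); have Wy : oset W (sval y) by split; last exact: svalP.
  have := ss j i W (@ocapl _ _ _) (@ocapr _ _ _).
  move=> /(congr1 (fun g => reg_val g (exist _ _ Wy : opoint W))) /=.
  have -> : oincl (@ocapr _ _ _) (exist _ (sval y) Wy) = y by exact: opoint_eq.
  by move=> <-; congr (reg_val _ _); apply: opoint_eq.
have fr : regular f.
  apply: regular_local => x; have [i _ Dx] := cov _ (svalP x).
  exists (D i), (DU i); split=> //.
  have -> : f \o oincl (DU i) = s i by apply: funext => y; apply: fE.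
  exact: reg_funP.
exists (mk_reg fr) => i; apply: reg_fun_eq => y; exact: fE.
Qed.

Definition reg_calg U : calg R[i] := @CAlg _ (reg_fun U) (reg_scal U).

Lemma reg_res_scal U V (VU : V ⊂ U) (c : R[i]) :
  reg_res VU (reg_scal U c) = reg_scal V c.
Proof. exact: reg_fun_eq. Qed.

Definition structSheaf : algSheaf R[i] X :=
  @AlgSheaf _ X reg_calg (fun U V VU => reg_res VU) reg_res_scal reg_resP.

End StructureSheaf.

Section Varieties.
Variable R : realType.

Definition poly_eval (N : nat) (p : mpoly.mpoly N R[i]) (v : 'rV[R[i]]_N) : R[i] :=
  mpoly.meval (fun j => v ord0 j) p.

Definition zariski_closed (N : nat) (Z : set 'rV[R[i]]_N) : Prop :=
  exists S : set (mpoly.mpoly N R[i]),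
    Z = [set v | forall p, S p -> poly_eval p v = 0].

Variable X : fspace R.

(* [h] identifies the open set [U], with its regular functions, with a Zariski
   closed subset of C^N, on which the regular functions are those which are
   locally quotients of polynomials. *)
Record affine_chart (U : opens X) (N : nat) (h : X -> 'rV[R[i]]_N) : Prop :=
  AffineChart {
  chart_inj : forall x y, oset U x -> oset U y -> h x = h y -> x = y;
  chart_closed : zariski_closed [set h x | x in oset U];
  chart_open : forall W : set X, W `<=` oset U ->
    (open W <-> exists2 Z, zariski_closed Z &
                  W = [set x | oset U x /\ ~ Z (h x)]);
  chart_regular : forall W : opens X, W ⊂ U -> forall f : opoint W -> R[i],
    (regular f <->
     forall x : opoint W, exists (p q : mpoly.mpoly N R[i]) (V : opens X),
       oset V (sval x) /\ forall y : opoint W, oset V (sval y) ->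
         poly_eval q (h (sval y)) != 0 /\
         f y = poly_eval p (h (sval y)) / poly_eval q (h (sval y)))
}.

(* The image of the diagonal in U x U', for all affine charts, is closed. *)
Definition separated : Prop :=
  forall (U U' : opens X) (N N' : nat)
    (h : X -> 'rV[R[i]]_N) (h' : X -> 'rV[R[i]]_N'),
    affine_chart U h -> affine_chart U' h' ->
    zariski_closed [set row_mx (h x) (h' x) | x in oset U `&` oset U'].

Definition is_variety : Prop :=
  (exists (k : nat) (U : 'I_k -> opens X),
     (forall i, exists (N : nat) (h : X -> 'rV[R[i]]_N), affine_chart (U i) h) /\
     (forall x, exists i, oset (U i) x)) /\
  separated.

(* The differential at h(x) of p, applied to v. *)
Definition differential (N : nat) (p : mpoly.mpoly N R[i]) (a v : 'rV[R[i]]_N) :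
  R[i] := \sum_(j < N) poly_eval (mpoly.mderiv j p) a * v ord0 j.

Definition tangent_space (U : opens X) (N : nat) (h : X -> 'rV[R[i]]_N) (x : X) :
  set 'rV[R[i]]_N :=
  [set v | forall p : mpoly.mpoly N R[i],
     (forall y, oset U y -> poly_eval p (h y) = 0) -> differential p (h x) v = 0].

Definition has_dim (N : nat) (T : set 'rV[R[i]]_N) (d : nat) : Prop :=
  exists B : 'M[R[i]]_(d, N), row_free B /\ forall v, T v <-> (v <= B)%MS.

Definition irreducible_closed (Z : set X) : Prop :=
  [/\ closed Z, Z !=set0 &
      forall A B : set X, closed A -> closed B ->
        Z `<=` A `|` B -> Z `<=` A \/ Z `<=` B].

Definition irreducible_chain (x : X) (d : nat) : Prop :=
  exists Z : nat -> set X,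
    [/\ forall k, (k <= d)%N -> irreducible_closed (Z k),
        forall k, (k < d)%N -> Z k `<` Z k.+1 & Z 0%N x].

(* The Krull dimension of the local ring of X at x is d. *)
Definition local_dim (x : X) (d : nat) : Prop :=
  irreducible_chain x d /\
  forall e, irreducible_chain x e -> (e <= d)%N.

Definition smooth_at (x : X) : Prop :=
  forall (U : opens X) (N : nat) (h : X -> 'rV[R[i]]_N),
    affine_chart U h -> oset U x ->
    exists d, local_dim x d /\ has_dim (tangent_space U h x) d.

Definition smooth : Prop := forall x, smooth_at x.

End Varieties.

(* Main.v *)
(* An automorphism f in the kernel has the form p |-> p + d(p) t^(n-1), where d
   is additive and d(pq) = p_0 d(q) + q_0 d(p); splitting p = p_0 + t s gives
   d(p) = D(p_0) + b p_1 for the derivation D = d restricted to constants and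
   the function b = d(t).  Conversely every pair (D, b) occurs.  Since n > 2, f
   does not change p_0 and p_1, so that composition adds the pairs. *)
Require Import Defs.
From mathcomp Require Import all_boot all_order all_algebra.
From mathcomp Require Import boolp classical_sets functions reals topology.

Local Open Scope classical_set_scope.

Set Implicit Arguments.
Unset Strict Implicit.
Unset Printing Implicit Defensive.

Import GRing.Theory.
Local Open Scope ring_scope.

(** * Monomials of top degree in A[t]/(t^m) *)

Section TopCoefficient.
Variables (A : comPzRingType) (m : nat).
Implicit Types (p q : tpoly A m) (c d : A).

(** The monomial c t^(m-1); these form the kernel of the reduction to A[t]/(t^(m-1)). *)
Definition ttop c : tpoly A m := tmk m (fun k => if k == m.-1 then c else 0).

Lemma tcoef_top c k : (k < m)%N ->
  tcoef (ttop c) k = if k == m.-1 then c else 0.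
Proof. by move=> km; rewrite tcoef_mk km. Qed.

Lemma tcoef_top_small c k : (k < m.-1)%N -> tcoef (ttop c) k = 0.
Proof.
by move=> km; rewrite tcoef_top ?ltn_eqF // (leq_trans km) ?leq_pred.
Qed.

Lemma ttopD : {morph ttop : c d / c + d}.
Proof.
move=> c d; apply: tpolyP => k km; rewrite tcoefD !tcoef_top //.
by case: eqP; rewrite ?addr0.
Qed.

Lemma ttop0 : ttop 0 = 0.
Proof. by apply: (addrI (ttop 0)); rewrite -ttopD !addr0. Qed.

Lemma ttop_inj : (0 < m)%N -> injective ttop.
Proof.
move=> m_gt0 c d /(congr1 (tcoef^~ m.-1)).
by rewrite !tcoef_top ?eqxx // prednK.
Qed.

(** Since t^m = 0, multiplication by t^(m-1) kills everything but the constant term. *)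
Lemma ttopM c p : ttop c * p = ttop (c * tcoef p 0).
Proof.
have topE d : ttop d = tconst m d * tvar A m ^+ m.-1.
  apply: tpolyP => k km; rewrite tcoef_top // tcoef_constM //.
  rewrite -[_ ^+ _]mulr1 tcoef_varXM // tcoef1 subn_eq0.
  rewrite (leq_ltn_trans (leq_subr _ _)) //=.
  have {km} : (k <= m.-1)%N by rewrite -ltnS (ltn_predK km).
  by case: ltngtP => //= _ _; rewrite ?mulr1 ?mulr0.
apply: tpolyP => k km; rewrite topE -mulrA tcoef_constM // tcoef_varXM //.
rewrite tcoef_top //; have {km} : (k <= m.-1)%N by rewrite -ltnS (ltn_predK km).
by case: ltngtP => //= [_|->] _; rewrite ?subnn ?mulr0.
Qed.

Lemma mul_ttop c p : p * ttop c = ttop (tcoef p 0 * c).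
Proof. by rewrite mulrC ttopM mulrC. Qed.

(** Reduces an additive map obeying the Leibniz rule to its values on constants and on t. The last
    coefficient of the cofactor of t is [tcoef p m], which is 0 by default. *)
Lemma tpoly_split p : p = tconst m (tcoef p 0) +
  tvar A m * tmk m (fun k => tcoef p k.+1).
Proof.
apply: tpolyP => -[|k] km; rewrite tcoefD tcoef_const km /= tcoef_varM // ?addr0 //.
by rewrite add0r tcoef_mk ltnW.
Qed.

End TopCoefficient.

(** * The kernel over a single algebra A *)

Section KernelAlgebra.
Variables (K : comPzRingType) (A : calg K) (n : nat).
Hypothesis n_gt2 : (2 < n)%N.
Implicit Types (p q : tpoly A n) (f g : taut A n) (a b c : A) (D E : der A).

Let n_gt0 : (0 < n)%N. Proof. exact: ltn_trans n_gt2. Qed.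
Let n_gt1 : (1 < n)%N. Proof. exact: ltn_trans n_gt2. Qed.
Let n1_gt1 : (1 < n.-1)%N. Proof. by case: n n_gt2 => // -[]. Qed.
Let n1_gt0 : (0 < n.-1)%N. Proof. exact: ltnW. Qed.

(** It sends t to t + b t^(n-1) and each constant a to a + D(a) t^(n-1). *)
Definition tshift D b p : tpoly A n :=
  p + ttop n (D (tcoef p 0) + b * tcoef p 1).

Lemma tcoef_shift_small D b p k :
  (k < n.-1)%N -> tcoef (tshift D b p) k = tcoef p k.
Proof. by move=> kn; rewrite tcoefD tcoef_top_small ?addr0. Qed.

(** The outer correction reads only the coefficients of degree 0 and 1, which the inner one leaves
    alone because n-1 > 1. *)
Lemma tshift_comp D E b c p :
  tshift D b (tshift E c p) = tshift (D + E) (b + c) p.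
Proof.
rewrite {1}/tshift !tcoef_shift_small // /tshift -addrA -ttopD.
congr (_ + ttop _ _).
by rewrite mulrDl addrC addrACA.
Qed.

Lemma tshift0 p : tshift 0 0 p = p.
Proof. by rewrite /tshift mul0r addr0 ttop0 addr0. Qed.

(** The map p -> p_0 is multiplicative and p -> p_1 obeys the Leibniz rule over it, hence so does p
    -> D(p_0) + b p_1. By [tshift_comp] the inverse has parameters -D and -b. *)
Lemma tshift_taut D b : is_taut (tshift D b).
Proof.
have [DD DM Dc] := derP D; split.
- move=> p q; rewrite /tshift addrACA -ttopD !tcoefD DD mulrDr.
  by rewrite [in LHS]addrACA.
- move=> p q; rewrite /tshift mulrDl !mulrDr !ttopM !mul_ttop.
  (* The product of the two corrections vanishes: a monomial of degree n-1 > 0 has constant term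
     0. *)
  rewrite tcoef_top_small // mulr0 ttop0 addr0 -!addrA -ttopD.
  congr (_ + ttop _ _).
  have -> : tcoef (p * q) 0 = tcoef p 0 * tcoef q 0.
    by rewrite tcoefM // big_ord1.
  have -> : tcoef (p * q) 1 = tcoef p 0 * tcoef q 1 + tcoef p 1 * tcoef q 0.
    by rewrite tcoefM // !big_ord_recl big_ord0 addr0.
  rewrite DM !(mulrDr, mulrDl) addrACA; congr (_ + _ + (_ + _)).
  + exact: mulrCA.
  + exact: mulrC.
  + exact: mulrA.
- move=> c; rewrite /tshift !tcoef_const n_gt0 andbF /= Dc mulr0 addr0.
  by rewrite ttop0 addr0.
- by exists (tshift (- D) (- b)) => p;
    rewrite tshift_comp ?(addNr, addrN) tshift0.
- by move=> p; rewrite tcoef_shift_small.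
Qed.

Definition shift_taut D b : taut A n := Taut (tshift_taut D b).

Lemma shift_taut_red D b : taut_red (leq_pred n) (shift_taut D b) = 1%g.
Proof.
apply: taut_eq => q; apply: tpolyP => k kn /=.
by rewrite tcoef_mk kn tcoef_shift_small // tcoef_mk (leq_trans kn) ?leq_pred.
Qed.

(** The map d with f(p) = p + d(p) t^(n-1) for f in the kernel; reading off a coefficient defines it
    for every automorphism, without a proof of membership. *)
Definition tdev f p : A := tcoef (f p - p) n.-1.

Section InKernel.
Variable f : taut A n.
Hypothesis fker : taut_red (leq_pred n) f = 1%g.

Lemma ker_tautE p : f p = p + ttop n (tdev f p).
Proof.
apply: tpolyP => k kn; rewrite tcoefD tcoef_top //.
case: eqP => [->|/eqP]; first by rewrite /tdev tcoefB addrC subrK.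
move=> kn1; have {}kn1 : (k < n.-1)%N by rewrite ltn_neqAle kn1 -ltnS (ltn_predK kn).
(* Below degree n-1 the coefficients are those of the induced automorphism, which is the
   identity. *)
have := taut_redE (leq_pred n) f p; rewrite fker => /(congr1 (tcoef^~ k)).
by rewrite /= !tcoef_mk kn1 addr0.
Qed.

Lemma tdevD p q : tdev f (p + q) = tdev f p + tdev f q.
Proof.
by have [fD _ _ _ _] := tautP f; rewrite /tdev fD -tcoefD opprD addrACA.
Qed.

(** Compare top coefficients in f(pq) = f(p) f(q): once pq is cancelled only the cross terms remain,
    the product of the two corrections being 0. *)
Lemma tdevM p q :
  tdev f (p * q) = tcoef p 0 * tdev f q + tcoef q 0 * tdev f p.
Proof.
have [_ fM _ _ _] := tautP f; apply: (ttop_inj n_gt0); apply: (addrI (p * q)).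
rewrite -ker_tautE fM !ker_tautE mulrDl !mulrDr !ttopM !mul_ttop.
rewrite tcoef_top_small // mulr0 ttop0 addr0 -!addrA -ttopD.
by rewrite (mulrC (tdev f p)).
Qed.

Lemma dev_der_subproof : (fun a => tdev f (tconst n a)) \in der_pred (A := A).
Proof.
have [_ _ fc _ _] := tautP f; apply/asboolP; split.
- move=> a b; rewrite -tdevD; congr tdev; apply: tpolyP => k kn.
  by rewrite tcoefD !tcoef_const; case: ifP; rewrite ?addr0.
- move=> a b.
  have -> : tconst n (a * b) = tconst n a * tconst n b.
    apply: tpolyP => k kn; rewrite tcoef_constM // !tcoef_const.
    by case: ifP; rewrite ?mulr0.
  by rewrite tdevM !tcoef_const n_gt0.
- by move=> c; rewrite /tdev fc subrr tcoef0.
Qed.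

Definition dev_der : der A := Der dev_der_subproof.

Lemma tdevE p : tdev f p = dev_der (tcoef p 0) + tdev f (tvar A n) * tcoef p 1.
Proof.
(* In d(ts) = t_0 d(s) + s_0 d(t) the first term vanishes, and s_0 = p_1. *)
rewrite {1}(tpoly_split p) tdevD tdevM /= !tcoef_mk n_gt0 /= mul0r add0r.
by rewrite mulrC.
Qed.

Lemma ker_taut_shift p : f p = tshift dev_der (tdev f (tvar A n)) p.
Proof. by rewrite ker_tautE tdevE. Qed.

End InKernel.

(** The map d of f kills the correction added by g, whose coefficients in degrees 0 and 1 vanish as
    n-1 > 1. For n = 2 the values b, c at t would compose to b + c + bc. *)
Lemma tdev_comp f g p : taut_red (leq_pred n) f = 1%g ->
  taut_red (leq_pred n) g = 1%g -> tdev (f * g)%g p = tdev f p + tdev g p.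
Proof.
move=> fk gk; rewrite {1}/tdev /= (ker_tautE fk) (ker_tautE gk).
rewrite (tdevD f) (tdevE fk (ttop _ _)) !tcoef_top_small // mulr0 addr0.
have [DD _ _] := derP (dev_der fk).
have -> : dev_der fk 0 = 0 by apply: (addrI (dev_der fk 0)); rewrite -DD !addr0.
rewrite addr0 -[p + _ + _]addrA -ttopD addrAC subrr add0r tcoef_top ?prednK // eqxx.
exact: addrC.
Qed.

Lemma tdev_shift D b p :
  tdev (shift_taut D b) p = D (tcoef p 0) + b * tcoef p 1.
Proof. by rewrite /tdev /= addrAC subrr add0r tcoef_top ?prednK // eqxx. Qed.

End KernelAlgebra.

(** * Compatibility with restriction and the isomorphism of sheaves *)

Section KernelSheaf.
Variables (K : comPzRingType) (X : topologicalType) (O : algSheaf K X) (n : nat).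
Hypothesis n_gt2 : (2 < n)%N.
Implicit Types U V W : opens X.

Let kersh := ker_sheaf (rho O n).
Let sumsh := ab_gpSheaf (dsum_sheaf (tangentSheaf O) (add_sheaf O)).

Definition ker_taut U (s : kersh U) V (VU : V ⊂ U) : taut (O V) n :=
  aut_val (ker_val s) VU.

Lemma ker_taut_red U (s : kersh U) V (VU : V ⊂ U) :
  taut_red (leq_pred n) (ker_taut s VU) = 1%g.
Proof.
have := valP s; rewrite unfold_in => /eqP.
by move=> /(congr1 (fun z => fam_val z VU)).
Qed.

(** Restriction acts coefficientwise and commutes with the family [s]. This makes both the
    derivations and the function d(t) compatible with restriction. *)
Lemma tdev_res U (s : kersh U) V W (VU : V ⊂ U) (WU : W ⊂ U) (WV : W ⊂ V) p :
  ares O WV (tdev (ker_taut s VU) p) = tdev (ker_taut s WU) (tres WV p).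
Proof.
rewrite /tdev -tcoef_res /ker_taut -(aut_valP _ VU WU); congr tcoef.
by apply: tpolyP => k kn; rewrite tcoefB !tcoef_res tcoefB rmorphB.
Qed.

Lemma ker_der_subproof U (s : kersh U) V W (VU : V ⊂ U) (WU : W ⊂ U)
    (WV : W ⊂ V) (a : O V) :
  ares O WV (dev_der n_gt2 (ker_taut_red s VU) a) =
  dev_der n_gt2 (ker_taut_red s WU) (ares O WV a).
Proof. by rewrite /= (tdev_res _ _ WU) /tres tmap_const. Qed.

Definition ker_tan U (s : kersh U) : tan_sec O U :=
  @Fam _ _ (fun U V VU => ares O VU) _ (fun V => @der_fun K (O V)) U
    (fun V VU => dev_der n_gt2 (ker_taut_red s VU)) (ker_der_subproof s).

(** A section of O is a single element, so d(t) is read off over U alone, whereas the derivation is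
    a family over all open V in U. *)
Definition ker_fun U (s : kersh U) : O U :=
  tdev (ker_taut s (@osub_refl X U)) (tvar (O U) n).

Definition ker_to_sum U (s : kersh U) : sumsh U := (ker_tan s, ker_fun s).

Lemma tres_var U V (VU : V ⊂ U) : tres VU (tvar (O U) n) = tvar (O V) n.
Proof.
apply: tpolyP => k kn; rewrite tcoef_res !tcoef_mk kn.
by case: ifP; rewrite ?rmorph1 ?rmorph0.
Qed.

Lemma ker_fun_res U (s : kersh U) V (VU : V ⊂ U) :
  ares O VU (ker_fun s) = tdev (ker_taut s VU) (tvar (O V) n).
Proof. by rewrite /ker_fun (tdev_res _ _ VU) tres_var. Qed.

Lemma ker_to_sumM U : {morph @ker_to_sum U : s t / (s * t)%g}.
Proof.
move=> s t; have dev V (VU : V ⊂ U) p :=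
  tdev_comp n_gt2 p (ker_taut_red s VU) (ker_taut_red t VU).
congr (_, _); last exact: dev.
by apply: fam_eq => V VU; apply: der_eq => a; apply: dev.
Qed.

Lemma ker_to_sumR U V (VU : V ⊂ U) (s : kersh U) :
  ker_to_sum (gres VU s) = gres VU (ker_to_sum s).
Proof.
congr (_, _); first by apply: fam_eq => W WV; apply: der_eq.
by rewrite /= ker_fun_res /ker_fun /ker_taut; congr (tdev _ _).
Qed.

Definition ker_mor : gpMor kersh sumsh := GpMor ker_to_sumM ker_to_sumR.

Definition shift_fam U (D : tan_sec O U) (b : O U) V (VU : V ⊂ U) :
  taut (O V) n := shift_taut n_gt2 (tan_val D VU) (ares O VU b).

Lemma shift_fam_subproof U (D : tan_sec O U) (b : O U) V W (VU : V ⊂ U)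
    (WU : W ⊂ U) (WV : W ⊂ V) p :
  tres WV (shift_fam D b VU p) = shift_fam D b WU (tres WV p).
Proof.
rewrite /= tresD; congr (_ + _); apply: tpolyP => k kn.
have [_ Oc _ _] := aresP O.
rewrite tcoef_res !tcoef_top // (fun_if (ares O WV)) rmorph0 rmorphD rmorphM.
by rewrite !tcoef_res (tan_valP D VU WU) (Oc _ _ _ _ _ WU).
Qed.

Definition shift_aut U (D : tan_sec O U) (b : O U) : aut_sec O n U :=
  Fam (fam_val := shift_fam D b) (shift_fam_subproof D b).

Lemma shift_aut_ker U (D : tan_sec O U) (b : O U) :
  shift_aut D b \in ker_pred (rho O n) (U := U).
Proof.
rewrite unfold_in; apply/eqP; apply: fam_eq => V VU.
exact: shift_taut_red.
Qed.

Definition sum_to_ker U (x : sumsh U) : kersh U :=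
  KerSec (shift_aut_ker x.1 x.2).

Lemma ker_to_sumK U : cancel (@ker_to_sum U) (@sum_to_ker U).
Proof.
move=> s; apply: val_inj; apply: fam_eq => V VU; apply: taut_eq => p.
(* The restriction to V of d(t) over U is d(t) over V, so the description of kernel elements applies
   on each V. *)
rewrite /= ker_fun_res; symmetry.
exact: (ker_taut_shift n_gt2 (ker_taut_red s VU)).
Qed.

Lemma sum_to_kerK U : cancel (@sum_to_ker U) (@ker_to_sum U).
Proof.
have n_gt0 : (0 < n)%N by apply: ltn_trans n_gt2.
have n_gt1 : (1 < n)%N by apply: ltn_trans n_gt2.
move=> [D b]; congr (_, _).
  apply: fam_eq => V VU; apply: der_eq => a /=.
  (* A constant a has coefficients a and 0 in degrees 0 and 1, which isolates D(a). *)
  by rewrite tdev_shift !tcoef_const n_gt0 andbF mulr0 addr0.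
have [Oi _ _ _] := aresP O; have [DD _ _] := derP (tan_val D (@osub_refl X U)).
(* The variable t has coefficients 0 and 1 there, which gives D(0) + b. *)
rewrite /ker_fun tdev_shift !tcoef_mk n_gt0 n_gt1 mulr1 Oi.
set d := tan_val _ _ in DD *; have -> : d 0 = 0; last exact: add0r.
by apply: (addrI (d 0)); rewrite -DD !addr0.
Qed.

Lemma ker_rho_isomorphic : gp_isomorphic kersh sumsh.
Proof.
by exists ker_mor => U; exists (@sum_to_ker U);
  [exact: ker_to_sumK | exact: sum_to_kerK].
Qed.

End KernelSheaf.

Theorem proposition4p4p1 (R : realType) (X : fspace R) (n : nat) :
  is_variety X -> smooth X -> [set: X] !=set0 -> connected [set: X] ->
  (2 < n)%N ->
  gp_isomorphic (ker_sheaf (rho (structSheaf X) n))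
    (ab_gpSheaf
       (dsum_sheaf (tangentSheaf (structSheaf X)) (add_sheaf (structSheaf X)))).
Proof. by move=> _ _ _ _; apply: ker_rho_isomorphic. Qed.
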